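(* Let $X$ be a normal space which is locally null with respect to an ideal $\mathfrak{I}$ in $X$. Then $C^{\mathfrak I}_{00}(X)$ is an ideal of $C_B(X)$ which is isometrically isomorphic (as a normed algebra) to $C_{00}(Y)$ for some locally compact space $Y$ which is unique up to homeomorphism, namely for $Y=\lambda_{\mathfrak I}X$. Furthermore: (1) $X$ is contained in $Y$ as a dense subspace. (2) $C^{\mathfrak I}_{00}(X)$ is non-vanishing. (3) The following are equivalent: $C^{\mathfrak I}_{00}(X)$ is unital; $\mathfrak I$ is non-proper; $Y$ is compact.
   Context: Completely regular, compact and locally compact spaces are assumed to be Hausdorff, and normal spaces are Hausdorff as well (hence completely regular). The scalar field is $\mathbb{C}$. $C_B(X)$ is the normed algebra of continuous bounded $f:X\to\mathbb{C}$ with the supremum norm. For continuous $f:X\to\mathbb{C}$, $\mathrm{coz}(f)=X\setminus f^{-1}(0)$ and $\mathrm{supp}(f)=\mathrm{cl}_X\mathrm{coz}(f)$; $\mathrm{Coz}(X)$ is the set of all cozero-sets $\mathrm{coz}(f)$ of $X$. $C_{00}(Y)$ is the set of $f\in C_B(Y)$ with compact support. $\beta X$ is the Stone–Čech compactification of $X$, with $X\subseteq\beta X$. An ideal $\mathfrak I$ in a set $X$ is a non-empty collection of subsets of $X$ closed under taking subsets and finite unions; its elements are called null sets; $\mathfrak I$ is proper if $X$ is not null (non-proper otherwise). A neighborhood of $A\subseteq X$ in $X$ is a set $U\subseteq X$ with $A\subseteq\mathrm{int}_XU$. A space $X$ is locally null (with respect to $\mathfrak I$) if each point of $X$ has a null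 neighborhood in $X$. Define $$C^{\mathfrak I}_{00}(X)=\{f\in C_B(X):\mathrm{supp}(f)\text{ has a null neighborhood in }X\}$$ and $$\lambda_{\mathfrak I}X=\bigcup\{\mathrm{int}_{\beta X}\mathrm{cl}_{\beta X}C:C\in\mathrm{Coz}(X)\text{ and }\mathrm{cl}_XC\text{ has a null neighborhood in }X\}\subseteq\beta X.$$ An ideal $H$ of $C_B(X)$ is non-vanishing if for every $x\in X$ there is $h\in H$ with $h(x)\neq0$. An ideal of $C_B(X)$ is unital if, as an algebra, it has a multiplicative identity. *)

(* Defs.v *)
(* The scalars are the complex numbers R[i] over an arbitrary R : realType. *)
From HB Require Import structures.
From mathcomp Require Import all_boot all_order all_algebra.
From mathcomp Require Import complex.
From mathcomp Require Import all_classical reals topology normedtype.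

Set Implicit Arguments.
Unset Strict Implicit.
Unset Printing Implicit Defensive.

Import Order.TTheory GRing.Theory Num.Theory.
Import numFieldNormedType.Exports.

Local Open Scope classical_set_scope.
Local Open Scope ring_scope.
Local Open Scope complex_scope.

(* The usual topology, uniformity and norm of R[i].  The library provides them
   for an abstract numClosedFieldType only. *)
HB.instance Definition _ (R : rcfType) :=
  PseudoPointedMetric.copy R[i] (R[i] : numClosedFieldType)^o.
HB.instance Definition _ (R : rcfType) :=
  GRing.ComAlgebra.copy R[i] (R[i] : numClosedFieldType)^o.
HB.instance Definition _ (R : rcfType) :=
  Vector.copy R[i] (R[i] : numClosedFieldType)^o.
HB.instance Definition _ (R : rcfType) :=
  NormedModule.copy R[i] (R[i] : numClosedFieldType)^o.

Section embeddings.
Variables S T : topologicalType.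

Definition topological_embedding (f : S -> T) : Prop :=
  [/\ injective f, continuous f &
      forall U : set S, open U -> exists2 V : set T, open V & f @^-1` V = U].

Definition homeomorphic : Prop :=
  exists (f : S -> T) (g : T -> S),
    [/\ continuous f, continuous g, cancel f g & cancel g f].

End embeddings.

(* In the library, local compactness does not include the Hausdorff axiom. *)
Definition locally_compact_hausdorff (T : topologicalType) : Prop :=
  hausdorff_space T /\ locally_compact [set: T].

Section function_algebras.
Variables (R : realType) (X : topologicalType).

(* The algebra operations on X -> R[i] are the pointwise ones of the library,
   so C_B(X) is a set of functions rather than a separate type. *)
Definition CB : set (X -> R[i]) := [set f | continuous f /\ bounded_fun f].

(* The norm of R[i] takes its values in R[i]; normc is the same norm with
   values in R.  The norm is 0 on the zero algebra C_B(set0). *)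
Definition sup_norm (f : X -> R[i]) : R :=
  sup [set Normc.normc (f x) | x in [set: X]].

Definition coz (f : X -> R[i]) : set X := [set x | f x != 0].

Definition supp (f : X -> R[i]) : set X := closure (coz f).

Definition Coz : set (set X) :=
  [set C | exists2 f : X -> R[i], continuous f & C = coz f].

Definition C00 : set (X -> R[i]) := [set f | CB f /\ compact (supp f)].

Definition CB_ideal (H : set (X -> R[i])) : Prop :=
  [/\ H `<=` CB, H !=set0,
      forall f g, H f -> H g -> H (f + g) &
      forall f g, CB f -> H g -> H (f * g)].

Definition non_vanishing (H : set (X -> R[i])) : Prop :=
  forall x, exists2 h, H h & h x != 0.

(* The identity of H need not be the constant function 1. *)
Definition unital (H : set (X -> R[i])) : Prop :=
  exists2 u, H u & forall f, H f -> u * f = f /\ f * u = f.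

End function_algebras.

Arguments CB R X : clear implicits.
Arguments Coz R X : clear implicits.
Arguments C00 R X : clear implicits.

Definition isometrically_isomorphic (R : realType) (X Y : topologicalType)
    (A : set (X -> R[i])) (B : set (Y -> R[i])) : Prop :=
  exists phi : (X -> R[i]) -> (Y -> R[i]),
    [/\ set_bij A B phi,
        forall (a : R[i]) f g, A f -> A g ->
          phi (a *: f + g) = a *: phi f + phi g,
        forall f g, A f -> A g -> phi (f * g) = phi f * phi g &
        forall f, A f -> sup_norm (phi f) = sup_norm f].

(* The Stone-Cech compactification by Tychonoff's construction: the closure of
   the image of X in the cube of all continuous maps from X to [0, 1].  The
   lemmas after the definitions check its characteristic properties. *)
Section stone_cech.
Variables (R : realType) (X : topologicalType).

Definition unit_interval_maps : set (X -> R) :=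
  [set f : X -> R | continuous f /\ forall x, 0 <= f x <= 1].

Definition stone_cech_eval (x : X) : {ptws unit_interval_maps -> R} :=
  fun f => set_val f x.

Definition stone_cech : topologicalType :=
  set_type (closure (range stone_cech_eval)).

Definition stone_cech_unit (x : X) : stone_cech :=
  exist _ (stone_cech_eval x)
    (mem_set (subset_closure (imageT stone_cech_eval x))).

End stone_cech.

Arguments unit_interval_maps R X : clear implicits.
Arguments stone_cech_unit R {X} x.

Lemma Re_continuous (R : realType) : continuous (@complex.Re R : R[i] -> R).
Proof.
move=> z; apply/(@cvgrPdist_lt _ _ _ (nbhs z) (nbhs_filter z)) => e e0.
have eC : 0 < e%:C :> R[i] by rewrite ltcR.
apply/nbhs_ballP; exists e%:C => //= w; rewrite -ball_normE /= => h.
by rewrite -ltcR; apply: le_lt_trans h; rewrite -raddfB; exact: normc_ge_Re.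
Qed.

Lemma Im_continuous (R : realType) : continuous (@complex.Im R : R[i] -> R).
Proof.
have -> : (@complex.Im R : R[i] -> R) = (@complex.Re R) \o ( *%R (- 'i)).
  by apply/funext => -[a b]/=; rewrite oppr0 !mul0r sub0r mulN1r opprK.
move=> z; apply: continuous_comp; last exact: Re_continuous.
exact: mulrl_continuous.
Qed.

Lemma real_complex_continuous (R : realType) :
  continuous (fun x : R => x%:C : R[i]).
Proof.
move=> x; apply/cvgrPdist_lt => e e0.
have [e' e'0 ->] : exists2 e' : R, 0 < e' & e = e'%:C.
  by case: e e0 => a b; rewrite ltcE/= => /andP[/eqP -> ?]; exists a.
apply/nbhs_ballP; exists e' => //= w; rewrite /ball/= => h.
by rewrite -raddfB/= normc_def/= expr0n addr0 sqrtr_sqr ltcR.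
Qed.

Lemma compact_set_type (T : topologicalType) (K : set T) :
  compact K -> compact [set: K].
Proof.
move=> cK F PF _.
have FK : (set_val @ F) K.
  by rewrite /= nbhs_simpl; apply: filterS (@filterT _ F _) => z _; exact: set_valP.
have [p [Kp clp]] := cK (set_val @ F) _ FK.
exists (exist _ p (mem_set Kp)); split=> // A B FA [_ [[V oV <-] Vp] VB].
have FA' : (set_val @ F) (set_val @` A).
  by rewrite /= nbhs_simpl; apply: filterS FA => z Az; exists z.
have [|_ [[a Aa <-] Va]] := clp _ V FA'; first exact: open_nbhs_nbhs.
by exists a; split => //; exact: VB.
Qed.

Section stone_cech_facts.
Variables (R : realType) (X : topologicalType).
Local Notation bX := (stone_cech R X).

Lemma stone_cech_hausdorff : hausdorff_space bX.
Proof.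
have hP : hausdorff_space {ptws unit_interval_maps R X -> R}.
  by apply: hausdorff_product => f; exact: order_hausdorff.
move=> p q pq; apply: val_inj; apply: hP => A B Ap Bq.
have cv := @initial_continuous bX _ set_val.
have [z [Az Bz]] := pq _ _ (cv p A Ap) (cv q B Bq).
by exists (set_val z).
Qed.

Lemma stone_cech_compact : compact [set: bX].
Proof.
apply: compact_set_type.
have cI : compact [set p : {ptws unit_interval_maps R X -> R} |
    forall f, p f \in `[0, 1]%R].
  apply: (@tychonoff _ (fun _ => R) (fun _ => [set` `[0, 1]%R])) => _.
  exact: segment_compact.
apply: (subclosed_compact _ cI); first exact: closed_closure.
have hP : hausdorff_space {ptws unit_interval_maps R X -> R}.
  by apply: hausdorff_product => f; exact: order_hausdorff.
rewrite [X in _ `<=` X](closure_id _).1; last exact: compact_closed.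
apply: closureS => _ [x _ <-] f /=; rewrite in_itv/=.
by have [_] := set_valP f; exact.
Qed.

Lemma stone_cech_unit_dense : dense (range (@stone_cech_unit R X)).
Proof.
move=> O [z Oz] [V oV VO]; rewrite -VO in Oz *.
have [|y [[x _ <-] Vx]] := set_mem (valP z) V; first exact: open_nbhs_nbhs.
by exists (stone_cech_unit R x); split => //; exists x.
Qed.

Let evalE : @stone_cech_eval R X =
  join_product (fun f : unit_interval_maps R X => set_val f : X -> R).
Proof. by []. Qed.

Lemma stone_cech_unit_embedding : hausdorff_space X -> normal_space X ->
  topological_embedding (@stone_cech_unit R X).
Proof.
move=> hX nX; have aX := hausdorff_accessible hX.
have cX f : unit_interval_maps R X f -> continuous f by case.
have sX : separate_points_from_closed
    (fun f : unit_interval_maps R X => set_val f : X -> R).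
  move=> U x cU Ux.
  have /uniform_separatorP-/(_ R)[f [cf f01 f0 f1]] :=
    @normal_completely_regular R _ nX aX x U cU Ux.
  have f01' : unit_interval_maps R X f.
    split => // y; have := f01 (f y) (imageT _ _); rewrite /= in_itv/=.
    exact: id.
  exists (exist _ f (mem_set f01')); rewrite set_valE /=.
  have -> : f x = 0 by apply: f0; exists x.
  move=> /(closureS f1); rewrite -(closure_id _).1.
    by move=> /esym/eqP; rewrite oner_eq0.
  exact: accessible_closed_set1 (hausdorff_accessible (@order_hausdorff _ R)) 1.
have cf (f : unit_interval_maps R X) : continuous (set_val f : X -> R).
  by apply: cX; exact: set_valP.
have inj := join_product_inj sX aX.
have oE := join_product_initial sX cf inj.
split.
- by move=> x y /(congr1 set_val) xy; apply: inj xy; rewrite inE.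
- apply/continuousP => _ [V oV <-]; rewrite oE -evalE.
  by exists V.
- move=> U; rewrite oE => -[V oV <-].
  by exists (set_val @^-1` V) => //; exists V.
Qed.

Let extend01 (f : X -> R) : unit_interval_maps R X f ->
  exists2 g : bX -> R, continuous g & forall x, g (stone_cech_unit R x) = f x.
Proof.
move=> uf; pose i : unit_interval_maps R X := exist _ f (mem_set uf).
exists (fun p : bX => (set_val p : {ptws _ -> R}) i) => // p.
apply: (@continuous_comp _ _ _ (set_val : bX -> {ptws _ -> R}) (@^~ i)).
  exact: initial_continuous.
exact: (@proj_continuous _ (fun=> R) i).
Qed.

Let extendM (M : R) (f : X -> R) : 0 < M -> continuous f ->
  (forall x, `|f x| <= M) ->
  exists2 g : bX -> R, continuous g & forall x, g (stone_cech_unit R x) = f x.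
Proof.
move=> M0 cf fM; have MM0 : 0 < M + M by exact: addr_gt0.
have [|g cg gE] := @extend01 (fun x => (f x + M) / (M + M)).
  split=> [x|x].
    apply: cvgM; last exact: cvg_cst.
    by apply: cvgD; [exact: cf|exact: cvg_cst].
  have := fM x; rewrite ler_norml => /andP[h1 h2].
  rewrite divr_ge0 ?(ltW MM0)// -?lerBlDr ?sub0r//=.
  by rewrite ler_pdivrMr// mul1r lerD2r.
exists (fun p => g p * (M + M) - M) => [p|x].
  apply: (@cvgB _ _ _ (nbhs p) (nbhs_filter p)); last exact: (@cvg_cst _ _ _ (nbhs p) (nbhs_filter p)).
  by apply: (@cvgM _ _ (nbhs p) (nbhs_filter p)); [exact: cg|exact: (@cvg_cst _ _ _ (nbhs p) (nbhs_filter p))].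
by rewrite gE mulfVK ?gt_eqF// addrK.
Qed.

Lemma stone_cech_extension (f : X -> R[i]) : CB R X f ->
  exists2 g : bX -> R[i], continuous g & forall x, g (stone_cech_unit R x) = f x.
Proof.
move=> [cf [M [Mreal bM]]].
have [N N0 fN] : exists2 N : R, 0 < N & forall x, `|f x| <= N%:C.
  exists (`|complex.Re M| + 1); first by rewrite ltr_pwDr.
  move=> x; apply: bM => //; case: M Mreal => a b.
  rewrite complex_real/= => /eqP ->; rewrite ltcR.
  by rewrite (le_lt_trans (ler_norm _))// ltrDl.
have [|x|g cg gE] := @extendM N (fun x => complex.Re (f x)) N0.
- by move=> x; apply: continuous_comp; [exact: cf|exact: Re_continuous].
- by rewrite -lecR (le_trans (normc_ge_Re _)).
have [|x|h ch hE] := @extendM N (fun x => complex.Im (f x)) N0.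
- by move=> x; apply: continuous_comp; [exact: cf|exact: Im_continuous].
- rewrite -lecR; apply: le_trans (fN x).
  case: (f x) => a b; rewrite normc_def/= lecR -sqrtr_sqr ler_wsqrtr//.
  by rewrite lerDr sqr_ge0.
exists (fun p => (g p)%:C + 'i * (h p)%:C) => [p|x].
  have cC (k : bX -> R) : continuous k -> continuous (fun q => (k q)%:C : R[i]).
    move=> ck q; apply: (@continuous_comp _ _ _ k (fun r : R => r%:C : R[i])).
      exact: ck.
    exact: real_complex_continuous.
  apply: (@cvgD _ _ _ (nbhs p) (nbhs_filter p)); first exact: cC.
  apply: (@cvgM _ _ (nbhs p) (nbhs_filter p)); last exact: cC.
  exact: (@cvg_cst _ _ _ (nbhs p) (nbhs_filter p)).
rewrite gE hE; case: (f x) => a b; apply/eqP; rewrite eq_complex/=.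
by rewrite !mulr0 !mul0r mul1r subrr addr0 !add0r !eqxx.
Qed.
End stone_cech_facts.

Section set_ideals.
Variables (R : realType) (X : topologicalType) (I : set (set X)).

(* The empty finite union is covered by the first two clauses. *)
Definition set_ideal : Prop :=
  [/\ I !=set0,
      forall A B, A `<=` B -> I B -> I A &
      forall A B, I A -> I B -> I (A `|` B)].

Definition has_null_nbhd (A : set X) : Prop :=
  exists2 U, I U & A `<=` U°.

Definition locally_null : Prop := forall x, has_null_nbhd [set x].

Definition C00_ideal : set (X -> R[i]) :=
  [set f | CB R X f /\ has_null_nbhd (supp f)].

Definition lambda_ideal : set (stone_cech R X) :=
  \bigcup_(C in [set C | Coz R X C /\ has_null_nbhd (closure C)])
    (closure (@stone_cech_unit R X @` C))°.

End set_ideals.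

Arguments C00_ideal R {X} I.
Arguments lambda_ideal R {X} I.

(* Main.v *)
(* The extension to the Stone-Cech compactification of a function f in
   C_00^I(X) has its support inside Y = lambda_I X: by normality some g in
   C_00^I(X) is 1 on supp f, the extension of g is then 1 on the support of the
   extension of f, and the cozero-set of the extension of g lies in
   int cl coz(g), the closure being taken in the compactification.  Conversely a compact subset of Y is covered by finitely many
   of the sets int cl C, so its trace on X has a null neighborhood.  Hence
   extension followed by restriction to Y maps C_00^I(X) onto C_00(Y),
   isometrically because X is dense in Y.  Uniqueness of Y is a Banach-Stone
   argument: the nonzero multiplicative functionals of C_00(Y) are the
   evaluations at the points of Y, and the cozero-sets of C_00(Y) form a base
   of Y. *)
Require Import Defs.
From HB Require Import structures.
From mathcomp Require Import all_boot all_order all_algebra.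
From mathcomp Require Import complex.
From mathcomp Require Import all_classical reals topology normedtype.

Set Implicit Arguments.
Unset Strict Implicit.
Unset Printing Implicit Defensive.

Import Order.TTheory GRing.Theory Num.Theory.
Import numFieldNormedType.Exports.

Local Open Scope classical_set_scope.
Local Open Scope ring_scope.

(** * General topology: compactness and embeddings *)

(* If P failed on K, the sets whose complement in K satisfies P would form a
   proper filter on K, with no cluster point. *)
Lemma compact_ind (T : topologicalType) (K : set T) (P : set (set T)) :
  compact K -> P set0 -> (forall A B, A `<=` B -> P B -> P A) ->
  (forall A B, P A -> P B -> P (A `|` B)) ->
  (forall x, K x -> exists2 U, nbhs x U & P U) -> P K.
Proof.
move=> cK P0 PS PU Ploc; apply: contrapT => nPK.
pose F : set (set T) := [set A | P (K `&` ~` A)].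
have FF : ProperFilter F.
  split; first by rewrite /F/= setC0 setIT.
  split; rewrite /F/=.
  - by rewrite setCT setI0.
  - by move=> A B PA PB; rewrite /= setCI setIUr; exact: PU.
  - by move=> A B AB; apply: PS; apply: setIS; exact: subsetC.
have FK : F K by rewrite /F/= setICr.
have [x [Kx clx]] := cK F FF FK.
have [U xU PU'] := Ploc x Kx.
have FU : F (~` U) by rewrite /F/= setCK; apply: PS PU'; exact: subIsetr.
by have [y []] := clx _ _ FU xU.
Qed.

Lemma compact_set_val (T : topologicalType) (A K : set T) :
  compact K -> K `<=` A -> compact (set_val @^-1` K : set (set_type A)).
Proof.
move=> cK KA F PF FK.
have FK' : (set_val @ F) K by [].
have [p [Kp clp]] := cK (set_val @ F) _ FK'.
exists (exist _ p (mem_set (KA _ Kp))); split=> // B C FB [_ [[V oV <-] Vp] VC].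
have FB' : (set_val @ F) (set_val @` B).
  by rewrite /= nbhs_simpl; apply: filterS FB => z Bz; exists z.
have [|_ [[b Bb <-] Vb]] := clp _ V FB'; first exact: open_nbhs_nbhs.
by exists b; split => //; exact: VC.
Qed.

Lemma embedding_closure (S T : topologicalType) (f : S -> T) (A : set S) x :
  topological_embedding f -> closure (f @` A) (f x) -> closure A x.
Proof.
move=> [_ _ fo] clx U; rewrite nbhsE => -[W [oW Wx] WU].
have [V oV VW] := fo W oW.
have [|_ [[y Ay <-] Vy]] := clx V.
  by apply: open_nbhs_nbhs; split => //; rewrite -VW in Wx.
by exists y; split => //; apply: WU; rewrite -VW.
Qed.

Lemma normc_ge0 (R : rcfType) (z : R[i]) : 0 <= Normc.normc z.
Proof. by case: z => a b; exact: sqrtr_ge0. Qed.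

(** * Continuous and bounded complex functions, supports *)

Section complex_functions.
Variables (R : realType) (X : topologicalType).
Implicit Types f g : X -> R[i].

Lemma cst_continuousC (a : R[i]) : continuous (fun _ : X => a).
Proof. by move=> x; exact: (@cvg_cst _ _ _ (nbhs x) (nbhs_filter x)). Qed.

Lemma addC_continuous f g : continuous f -> continuous g -> continuous (f + g).
Proof.
by move=> cf cg x; apply: (@cvgD _ _ _ (nbhs x) (nbhs_filter x));
  [exact: cf|exact: cg].
Qed.

Lemma mulC_continuous f g : continuous f -> continuous g -> continuous (f * g).
Proof.
by move=> cf cg x; apply: (@cvgM _ _ (nbhs x) (nbhs_filter x));
  [exact: cf|exact: cg].
Qed.

Lemma conjC_continuous f : continuous f -> continuous (fun x => (f x)^*%C).
Proof.
move=> cf x; apply/(@cvgrPdist_lt _ _ _ (nbhs x) (nbhs_filter x)) => e e0.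
have /(@cvgrPdist_lt _ _ _ (nbhs x) (nbhs_filter x))/(_ e e0) := cf x.
apply: filterS => y; rewrite -normcJ.
by rewrite (rmorphB (@conjc R)).
Qed.

Lemma coz_open f : continuous f -> open (coz f).
Proof.
move=> cf; rewrite openE => x fx0.
have /(@cvgrPdist_lt _ _ _ (nbhs x) (nbhs_filter x)) := cf x.
move=> /(_ `|f x|); rewrite normr_gt0 => /(_ fx0); apply: filterS => y.
by apply: contraTN => /eqP ->; rewrite subr0 ltxx.
Qed.

Lemma continuous_eq_closed f g : continuous f -> continuous g ->
  closed [set x | f x = g x].
Proof.
move=> cf cg; rewrite -openC.
have -> : ~` [set x | f x = g x] = coz (f + (cst (-1)) * g).
  apply/seteqP; split=> x /=; rewrite /coz /= /cst.
    by move=> /eqP; apply: contra_neq; rewrite !fctE mulN1r => /subr0_eq.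
  by move=> + fg; rewrite !fctE mulN1r fg subrr eqxx.
exact: coz_open (addC_continuous cf (mulC_continuous (@cst_continuousC _) cg)).
Qed.

Lemma eq_dense f g (S : set X) : dense S -> continuous f -> continuous g ->
  (forall x, S x -> f x = g x) -> f = g.
Proof.
move=> dS cf cg fg; apply/funext => x; apply: contrapT => nfg.
have [|y [ne Sy]] := dS (~` [set x | f x = g x]) (ex_intro _ x nfg).
  by rewrite openC; exact: continuous_eq_closed.
exact/ne/fg.
Qed.

(** Trades the bound of [bounded_fun], valid for all large [M] in [R[i]], for one real bound on the
    modulus. *)
Lemma CBP f : CB R X f <->
  continuous f /\ exists M : R, forall x, Normc.normc (f x) <= M.
Proof.
split=> -[cf].
  move=> [M [Mreal bM]]; split => //.
  exists (`|complex.Re M| + 1) => x.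
  rewrite -lecR; apply: bM => //; case: M Mreal => a b.
  rewrite complex_real/= => /eqP ->; rewrite ltcR.
  by rewrite (le_lt_trans (ler_norm _))// ltrDl.
move=> [M fM]; split => //; exists M%:C%C; split; first by rewrite complex_real/=.
by move=> N /ltW MN x _; apply: le_trans MN; rewrite lecR.
Qed.

Lemma CB_cst a : CB R X (cst a).
Proof. by apply/CBP; split; [exact: cst_continuousC|exists (Normc.normc a)]. Qed.

Lemma CB_D f g : CB R X f -> CB R X g -> CB R X (f + g).
Proof.
move=> /CBP[cf [M fM]] /CBP[cg [N gN]]; apply/CBP; split.
  exact: addC_continuous.
by exists (M + N) => x; rewrite (le_trans (le_normcD _ _))// lerD.
Qed.

Lemma CB_M f g : CB R X f -> CB R X g -> CB R X (f * g).
Proof.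
move=> /CBP[cf [M fM]] /CBP[cg [N gN]]; apply/CBP; split.
  exact: mulC_continuous.
exists (M * N) => x; rewrite Normc.normcM ler_pM//; exact: normc_ge0.
Qed.

Lemma supp_subset f x : coz f x -> supp f x.
Proof. exact: subset_closure. Qed.

Lemma suppD f g : supp (f + g) `<=` supp f `|` supp g.
Proof.
rewrite /supp -closureU; apply: closureS => x; rewrite /coz/= => h.
apply/orP; rewrite -negb_and; apply: contra h => /andP[/eqP f0 /eqP g0].
by rewrite fctE f0 g0 addr0.
Qed.

Lemma suppMr f g : supp (f * g) `<=` supp g.
Proof.
apply: closureS => x; rewrite /coz/= => h.
by apply: contra h => /eqP g0; rewrite fctE g0 mulr0.
Qed.

Lemma supp0 : supp (cst 0 : X -> R[i]) = set0.
Proof.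
rewrite /supp (_ : coz _ = set0) ?closure0// -subset0 => x.
by rewrite /coz/= eqxx.
Qed.

(** Continuity bounds [f] near each point, so [compact_ind] bounds it on the compact support; off
    the support it is 0. *)
Lemma C00_intro f : continuous f -> compact (supp f) -> C00 R X f.
Proof.
move=> cf ck; split => //; apply/CBP; split => //.
(* With [0 <= M], the bound also holds off the support, and [M + N] serves for a union. *)
suff [M M0 fM] : exists2 M : R, 0 <= M &
    forall x, supp f x -> Normc.normc (f x) <= M.
  exists M => x; have [sx|nsx] := pselect (supp f x); first exact: fM.
  have -> : f x = 0.
    by apply: contrapT => /eqP; exact: (contra_not (@supp_subset f x) nsx).
  by rewrite Normc.normc0.
apply: (@compact_ind _ (supp f) [set S | exists2 M : R, 0 <= M &
    forall x, S x -> Normc.normc (f x) <= M]) => //=.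
- by exists 0.
- by move=> A B AB [M M0 fM]; exists M => // x /AB; exact: fM.
- move=> A B [M M0 fM] [N N0 fN]; exists (M + N); first exact: addr_ge0.
  move=> x [/fM h|/fN h]; apply: le_trans h _; first by rewrite lerDl.
  by rewrite lerDr.
- move=> x _; have /(@cvgrPdist_lt _ _ _ (nbhs x) (nbhs_filter x)) := cf x.
  move=> /(_ 1 ltr01) h; eexists; first exact: h.
  exists (Normc.normc (f x) + 1); first by rewrite addr_ge0// normc_ge0.
  move=> y /= /ltW h1; rewrite -[f y](subrKC (f x)).
  apply: le_trans (le_normcD _ _) _; rewrite lerD2l.
  by rewrite -lecR; rewrite distrC in h1.
Qed.

End complex_functions.

(** * Sup norms on dense subsets; bump functions *)

Lemma sup_norm_dense (R : realType) (S T : topologicalType) (j : S -> T)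
    (f : T -> R[i]) : dense (range j) -> CB R T f ->
  sup_norm (f \o j) = sup_norm f.
Proof.
move=> dj /CBP[cf [M fM]].
have ubT : has_ubound [set Normc.normc (f x) | x in [set: T]].
  by exists M => _ [x _ <-].
have ubS : has_ubound [set Normc.normc ((f \o j) x) | x in [set: S]].
  by exists M => _ [x _ <-]; exact: fM.
(* If [T] is empty, both suprema are over the empty set. *)
have [[x0 _]|T0] := pselect ([set: T] !=set0); last first.
  rewrite /sup_norm; congr sup; apply/seteqP; split=> z [x _ _]; exfalso; apply: T0.
    by exists (j x).
  by exists x.
have [|_ [_ [s0 _ _]]] := dj setT _ openT; first by exists x0.
apply/eqP; rewrite eq_le; apply/andP; split.
  apply: ge_sup; first by exists (Normc.normc (f (j s0))), s0.
  by move=> _ [x _ <-]; apply: ub_le_sup => //; exists (j x).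
apply: ge_sup; first by exists (Normc.normc (f x0)), x0.
move=> _ [x _ <-]; rewrite leNgt; apply/negP => lt.
(* The radius is the assumed excess at [x]: density gives [j y] with [f (j y)] closer to [f x] than
   that, against the triangle inequality. *)
have e0 : 0 < (Normc.normc (f x) - sup_norm (f \o j))%:C%C :> R[i].
  by rewrite ltcR subr_gt0.
have /(@cvgrPdist_lt _ _ _ (nbhs x) (nbhs_filter x))/(_ _ e0) := cf x.
rewrite nbhsE => -[U [oU Ux] UM].
have [|z [Uy [y _ yE]]] := dj U _ oU; first by exists x.
rewrite -yE in Uy; have := UM _ Uy => /=; apply/negP/negbT/le_gtF.
have h : Normc.normc (f (j y)) <= sup_norm (f \o j).
  by apply: ub_le_sup => //; exists y.
rewrite -[X in _ <= X]/((Normc.normc (f x - f (j y)))%:C)%C lecR lerBlDr.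
rewrite -{1}[f x](subrK (f (j y))) (le_trans (le_normcD _ _))//.
by rewrite lerD2l.
Qed.

(** Complete regularity separates [z] from the complement of [O] intersected with the interior of a
    closed compact neighborhood [V]; the support then stays in [V]. *)
Lemma locally_compact_bump (R : realType) (Z : topologicalType) (O : set Z) z :
  locally_compact_hausdorff Z -> open O -> O z ->
  exists2 f, C00 R Z f & f z != 0 /\ coz f `<=` O.
Proof.
move=> [hZ lZ] oO Oz.
have [V zV [cV clV]] := lZ z I; rewrite withinET in zV.
have Wz : (O `&` V°) z by split.
have oW : open (O `&` V°) by apply: openI => //; exact: open_interior.
have /uniform_separatorP-/(_ R)[f [cf f01 f0 f1]] :=
  @locally_compact_completely_regular Z R lZ hZ z _ (open_closedC oW)
    (fun h => h Wz).
pose g := fun x => (1 - f x)%:C%C : R[i].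
have gW : coz g `<=` O `&` V°.
  move=> x; rewrite /coz/=; apply: contraPP => nW /eqP; apply.
  by rewrite /g (f1 (f x)) ?subrr//; exists x.
exists g; last first.
  split; last by move=> x /gW[].
  by rewrite /g (f0 (f z)) ?subr0 ?oner_eq0//; exists z.
apply: C00_intro.
  move=> x; apply: (@continuous_comp _ _ _ (fun x => 1 - f x) (fun r : R => r%:C%C : R[i])).
    by apply: cvgB; [exact: cvg_cst|exact: cf].
  exact: real_complex_continuous.
apply: (subclosed_compact _ cV); first exact: closed_closure.
rewrite /supp [X in _ `<=` X](closure_id _).1//; apply: closureS.
by move=> x /gW[_ /interior_subset].
Qed.

(** * Functions whose support has a null neighborhood *)

Section null_ideal.
Variables (R : realType) (X : topologicalType) (I : set (set X)).
Hypotheses (hX : hausdorff_space X) (nX : normal_space X).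
Hypotheses (idI : set_ideal I) (lnI : locally_null I).
Local Notation H := (C00_ideal R I).

Lemma has_null_nbhdS A B : A `<=` B -> has_null_nbhd I B -> has_null_nbhd I A.
Proof. by move=> AB [U IU BU]; exists U => // x /AB/BU. Qed.

Lemma has_null_nbhdU A B :
  has_null_nbhd I A -> has_null_nbhd I B -> has_null_nbhd I (A `|` B).
Proof.
have [_ _ IU] := idI.
move=> [U IU1 AU] [V IV BV]; exists (U `|` V); first exact: IU.
move=> x [/AU|/BV]; apply: filterS => y; first by left.
by right.
Qed.

Lemma has_null_nbhd0 : has_null_nbhd I set0.
Proof. by have [[A IA] _ _] := idI; exists A. Qed.

Lemma C00_ideal_CB_ideal : CB_ideal H.
Proof.
split.
- by move=> f [].
- by exists (cst 0); split; [exact: CB_cst|rewrite supp0; exact: has_null_nbhd0].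
- move=> f g [bf nf] [bg ng]; split; first exact: CB_D.
  by apply: has_null_nbhdS (has_null_nbhdU nf ng); exact: suppD.
- move=> f g bf [bg ng]; split; first exact: CB_M.
  by apply: has_null_nbhdS ng; exact: suppMr.
Qed.

(** Normality gives a neighborhood [V] of [D] with closure in the interior of the null set [U]. A
    Urysohn function that is 1 on [D] and 0 off the interior of [V] has its support in that
    closure. *)
Lemma null_nbhd_bump D : closed D -> has_null_nbhd I D ->
  exists2 g, H g & forall x, D x -> g x = 1.
Proof.
move=> cD [U IU DU].
have DU' : set_nbhs D U° by move=> x /DU/nbhs_interior.
have [V DV VU] := nX cD DU'.
have DVo : D `&` ~` V° = set0.
  by rewrite -subset0 => x [Dx]; apply; exact: DV.
have [] := @normal_separatorP R X; move=> + _ => /(_ nX).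
move=> /(_ _ _ (open_closedC (@open_interior _ V)) cD).
rewrite setIC => /(_ DVo) /uniform_separatorP-/(_ R)[f [cf f01 f0 f1]].
pose g := fun x => (f x)%:C%C : R[i].
have cg : continuous g.
  move=> x; apply: (@continuous_comp _ _ _ f (fun r : R => r%:C%C : R[i])).
    exact: cf.
  exact: real_complex_continuous.
exists g; last by move=> x Dx; rewrite /g (f1 (f x))//; exists x.
split.
  apply/CBP; split => //; exists 1 => x.
  rewrite /g/= expr0n addr0 sqrtr_sqr.
  have := f01 (f x) (imageT _ _); rewrite /= in_itv/= => /andP[h0 h1].
  by rewrite ger0_norm.
exists U => //; apply: subset_trans VU; apply: closureS => x.
rewrite /coz/=; apply: contraPP => nV /eqP; apply.
rewrite /g (f0 (f x))//; exists x => //.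
by move=> /= /interior_subset.
Qed.

Lemma C00_ideal_non_vanishing : non_vanishing H.
Proof.
move=> x; have [|g Hg g1] := null_nbhd_bump _ (lnI x).
  exact: accessible_closed_set1 (hausdorff_accessible hX) x.
by exists g => //; rewrite g1// oner_eq0.
Qed.

End null_ideal.

(** * The subspace [lam] of the Stone-Cech compactification *)

Section lambda.
Variables (R : realType) (X : topologicalType) (I : set (set X)).
Hypotheses (hX : hausdorff_space X) (nX : normal_space X).
Hypotheses (idI : set_ideal I) (lnI : locally_null I).
Local Notation H := (C00_ideal R I).
Local Notation bX := (stone_cech R X).
Local Notation eta := (@stone_cech_unit R X).
Local Notation lam := (lambda_ideal R I).
Let Y : topologicalType := set_type lam.

Let etaE : topological_embedding eta.
Proof. exact: stone_cech_unit_embedding. Qed.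

Lemma lambda_open : open lam.
Proof. by apply: bigcup_open => C _; exact: open_interior. Qed.

(** Since [coz h] is open and [X] is dense, each point of [coz h] is a limit of points of [X] where
    [h] is nonzero. *)
Lemma coz_stone_cech_extension (h : bX -> R[i]) : continuous h ->
  coz h `<=` (closure (eta @` coz (h \o eta)))°.
Proof.
move=> ch p hp; apply: filterS (open_nbhs_nbhs (conj (coz_open ch) hp)).
move=> q hq U; rewrite nbhsE => -[V [oV Vq] VU].
have [||z [[hz Vz] [x _ zE]]] := @stone_cech_unit_dense R X (coz h `&` V).
- by exists q.
- by apply: openI => //; exact: coz_open.
by exists (eta x); split; [exists x => //; rewrite /coz/= zE|rewrite zE; exact: VU].
Qed.

Lemma closure_stone_cech_eq1 (C : set X) (k : bX -> R[i]) p : continuous k ->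
  closure (eta @` C) p -> (forall x, C x -> k (eta x) = 1) -> k p = 1.
Proof.
move=> ck clp k1; suff : closure (eta @` C) `<=` [set q | k q = 1] by apply.
rewrite [X in _ `<=` X](closure_id _).1.
  by apply: closureS => _ [x Cx <-]; exact: k1.
exact: continuous_eq_closed ck (@cst_continuousC _ _ _).
Qed.

(** The trace of [coz h] on [X] is one of the cozero-sets indexing the union [lam]. *)
Lemma coz_extension_lambda (h : bX -> R[i]) : continuous h -> H (h \o eta) ->
  coz h `<=` lam.
Proof.
move=> ch [[cf bf] nf] p hp; exists (coz (h \o eta)).
  by split => //; exists (h \o eta).
exact: coz_stone_cech_extension.
Qed.

Lemma supp_extension_lambda (h : bX -> R[i]) : continuous h -> H (h \o eta) ->
  supp h `<=` lam.
Proof.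
move=> ch Hh; have [_ nh] := Hh.
have [g Hg g1] := @null_nbhd_bump R X I nX _ (@closed_closure _ _) nh.
have [Cg _] := Hg.
have [k ck kg] := stone_cech_extension Cg.
have Hk : H (k \o eta) by rewrite (_ : _ \o _ = g)//; apply/funext.
apply: subset_trans (coz_extension_lambda ck Hk).
suff hk : supp h `<=` [set p | k p = 1].
  by move=> p /hk; rewrite /coz/= => ->; rewrite oner_eq0.
rewrite [X in _ `<=` X](closure_id _).1; last first.
  exact: continuous_eq_closed ck (@cst_continuousC _ _ _).
(* Intersecting with the closure of the trace leaves [coz h] unchanged, and [k] is 1 on that
   closure. *)
have -> : supp h = closure (closure (eta @` coz (h \o eta)) `&` coz h).
  congr closure; apply/esym/setIidr => p /(coz_stone_cech_extension ch).
  exact: interior_subset.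
apply: closureS => p [clp _].
apply: (closure_stone_cech_eq1 ck clp) => x hx.
by rewrite kg g1//; exact: subset_closure.
Qed.

(** Some function of the ideal is nonzero at [x]; the cozero-set of its extension contains [eta x]
    and lies in [lam]. *)
Lemma eta_lambda x : lam (eta x).
Proof.
have [h Hh hx] := @C00_ideal_non_vanishing R X I hX nX lnI x.
have [Ch _] := Hh; have [k ck kh] := stone_cech_extension Ch.
have Hk : H (k \o eta) by rewrite (_ : _ \o _ = h)//; apply/funext.
by apply: (coz_extension_lambda ck Hk); rewrite /coz/= kh.
Qed.

Definition lambda_unit (x : X) : Y := exist _ (eta x) (mem_set (eta_lambda x)).
Local Notation j := lambda_unit.

Lemma lambda_unit_embedding : topological_embedding j.
Proof.
have [inj cont op] := etaE; split.
- by move=> x y /(congr1 set_val); exact: inj.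
- apply/continuousP => _ [V oV <-].
  by move/continuousP : cont => /(_ V oV).
- move=> U /op[V oV VU]; exists (set_val @^-1` V) => //.
  by exists V.
Qed.

Lemma lambda_unit_dense : dense (range j).
Proof.
move=> O [z Oz] [V oV VO]; rewrite -VO in Oz *.
(* As [lam] is open, its intersection with [V] is open in the compactification and meets [X]. *)
have [||w [[Vx lx] [x _ zE]]] := @stone_cech_unit_dense R X (V `&` lam).
- by exists (set_val z); split => //; exact: set_valP.
- by apply: openI => //; exact: lambda_open.
by exists (j x); split; [rewrite -zE in Vx|exists x].
Qed.

Lemma lambda_locally_compact : locally_compact_hausdorff Y.
Proof.
have cv : continuous (set_val : Y -> bX) := @initial_continuous _ _ _.
split.
  move=> p q pq; apply: val_inj; apply: (@stone_cech_hausdorff R X) => A B Ap Bq.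
  have [z [Az Bz]] := pq _ _ (cv p A Ap) (cv q B Bq).
  by exists (set_val z).
move=> p _; rewrite withinET.
have [C [cC nC] pC] := set_valP p.
have [g Hg g1] := @null_nbhd_bump R X I nX _ (@closed_closure _ _) nC.
have [Cg _] := Hg; have [k ck kg] := stone_cech_extension Cg.
have Hk : H (k \o eta) by rewrite (_ : _ \o _ = g)//; apply/funext.
(* The closure of the image of [C] is a compact neighborhood of [p]; it stays in [lam] because [k]
   is 1 on it. *)
have Clam : closure (eta @` C) `<=` lam.
  apply: subset_trans (coz_extension_lambda ck Hk).
  move=> q /(closure_stone_cech_eq1 ck) kq; rewrite /coz/= kq ?oner_eq0// => x Cx.
  by rewrite kg g1//; exact: subset_closure.
exists (set_val @^-1` closure (eta @` C)); first exact: cv.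
split.
  apply: compact_set_val => //.
  apply: (subclosed_compact _ (@stone_cech_compact R X)) => //.
  exact: closed_closure.
by apply: closed_comp; [move=> ? _; exact: cv|exact: closed_closure].
Qed.

Lemma compact_lambda_null (K : set Y) : compact K ->
  has_null_nbhd I (closure (j @^-1` K)).
Proof.
(* A closed [D] also contains the closure of the trace, and such sets are stable under finite
   unions. *)
move=> cK; suff [D [cD nD] KD] :
    exists2 D, closed D /\ has_null_nbhd I D & j @^-1` K `<=` D.
  apply: has_null_nbhdS nD; rewrite [X in _ `<=` X](closure_id _).1//.
  exact: closureS.
apply: (@compact_ind _ K [set S | exists2 D, closed D /\ has_null_nbhd I D &
    j @^-1` S `<=` D]) => //=.
- exists set0; last by rewrite preimage_set0.
  by split; [exact: closed0|exact: has_null_nbhd0].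
- by move=> A B AB [D hD BD]; exists D => // x /AB/BD.
- move=> A B [D [cD nD] AD] [E [cE nE] BE]; exists (D `|` E); last first.
    by move=> x [/AD|/BE]; [left|right].
  by split; [exact: closedU|exact: has_null_nbhdU].
- move=> p _; have [C [cC nC] pC] := set_valP p.
  exists (set_val @^-1` (closure (eta @` C))°).
    have cv : continuous (set_val : Y -> bX) := @initial_continuous _ _ _.
    by apply: cv; exact: open_nbhs_nbhs (conj (@open_interior _ _) pC).
  exists (closure C); first by split => //; exact: closed_closure.
  (* [eta] is an embedding, so a point of [X] in the closure of the image of [C] lies in the closure
     of [C] in [X]. *)
  by move=> x /interior_subset; exact: embedding_closure.
Qed.

Lemma C00_lambda_unit (f : Y -> R[i]) : C00 R Y f -> H (f \o j).
Proof.
have [_ cj _] := lambda_unit_embedding.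
move=> [/CBP[cf [M fM]] ksf]; split.
  apply/CBP; split; last by exists M => x; exact: fM.
  by move=> x; apply: continuous_comp; [exact: cj|exact: cf].
apply: has_null_nbhdS (compact_lambda_null ksf).
by apply: closureS => x fx; apply: (@supp_subset _ _ f).
Qed.

Lemma C00_ideal_isometric : isometrically_isomorphic H (C00 R Y).
Proof.
have [HCB H0 HD HM] := @C00_ideal_CB_ideal R X I idI.
(* Extensions are chosen for all functions at once, with default 0 outside [CB]. *)
have /choice[ext extP] (f : X -> R[i]) : exists k : bX -> R[i], CB R X f ->
    continuous k /\ forall x, k (eta x) = f x.
  have [Cf|nCf] := pselect (CB R X f); last by exists (cst 0).
  by have [k ck kf] := stone_cech_extension Cf; exists k.
have cv : continuous (set_val : Y -> bX) := @initial_continuous _ _ _.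
pose phi f : Y -> R[i] := ext f \o set_val.
have phij f : CB R X f -> forall x, phi f (j x) = f x.
  by move=> /extP[].
have cphi f : CB R X f -> continuous (phi f).
  move=> /extP[ce _] y; apply: continuous_comp; [exact: cv|exact: ce].
have phiC f : H f -> C00 R Y (phi f).
  move=> Hf; have [ce ej] := extP _ (HCB _ Hf).
  apply: C00_intro; first exact/cphi/HCB.
  have He : H (ext f \o eta) by rewrite (_ : _ \o _ = f)//; apply/funext.
  have ck : compact (set_val @^-1` (supp (ext f)) : set Y).
    apply: compact_set_val; last exact: supp_extension_lambda.
    apply: (subclosed_compact _ (@stone_cech_compact R X)) => //.
    exact: closed_closure.
  apply: (subclosed_compact _ ck); first exact: closed_closure.
  rewrite [X in _ `<=` X](closure_id _).1; last first.
    by apply: closed_comp; [move=> ? _; exact: cv|exact: closed_closure].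
  by apply: closureS => y fy; apply: (@supp_subset _ _ (ext f)).
(* By density a continuous function on [Y] is determined by its values on [X]; surjectivity and the
   algebra laws all follow from this. *)
have phi_eq f g : CB R X f -> continuous g -> (forall x, g (j x) = f x) ->
    phi f = g.
  move=> Cf cg gf; apply: (eq_dense lambda_unit_dense (cphi _ Cf) cg).
  by move=> _ [x _ <-]; rewrite phij.
exists phi; split.
- split.
  + by move=> f Hf; exact: phiC.
  + move=> f g; rewrite !inE => Hf Hg fg; apply/funext => x.
    by rewrite -(phij f (HCB _ Hf)) -(phij g (HCB _ Hg)) fg.
  + move=> g Cg; exists (g \o j); first exact: C00_lambda_unit.
    by apply: phi_eq => //; [exact/HCB/C00_lambda_unit|exact: Cg.1.1].
- move=> a f g Hf Hg; have [Cf Cg] := (HCB _ Hf, HCB _ Hg).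
  have -> : a *: f = cst a * f by [].
  have -> : a *: phi f = cst a * phi f by [].
  apply: phi_eq; first exact: CB_D (CB_M (CB_cst _ _) Cf) Cg.
    exact: addC_continuous (mulC_continuous (@cst_continuousC _ _ _) (cphi _ Cf)) (cphi _ Cg).
  by move=> x; rewrite !fctE !phij.
- move=> f g Hf Hg; have [Cf Cg] := (HCB _ Hf, HCB _ Hg).
  apply: phi_eq; first exact: CB_M.
    exact: mulC_continuous (cphi _ Cf) (cphi _ Cg).
  by move=> x; rewrite !fctE !phij.
- move=> f Hf; rewrite -(sup_norm_dense lambda_unit_dense (phiC _ Hf).1).
  by congr sup_norm; apply/funext => x /=; rewrite phij//; exact: HCB.
Qed.

(** Where the identity [u] vanished, every [h = u * h] would vanish, against non-vanishing; so the
    support of [u] is all of [X]. *)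
Lemma unital_null : unital H -> I [set: X].
Proof.
move=> [u [Cu [U IU sU]] uH].
have u1 x : u x != 0.
  have [h Hh hx] := @C00_ideal_non_vanishing R X I hX nX lnI x.
  have [/(congr1 (fun f => f x)) uh _] := uH h Hh.
  by apply: contra_neq hx => u0; rewrite -uh fctE u0 mul0r.
have [_ IS _] := idI; apply: IS IU => x _.
by apply: interior_subset; apply: sU; apply: (@supp_subset _ _ u); exact: u1.
Qed.

(** The constant 1 then lies in the ideal, and its extension is nowhere zero, so [lam] is the whole
    compactification. *)
Lemma null_compact : I [set: X] -> compact [set: Y].
Proof.
move=> IX; rewrite -(preimage_setT set_val); apply: compact_set_val.
  exact: stone_cech_compact.
suff Hk : H ((cst 1 : bX -> R[i]) \o eta).
  move=> p _; apply: (coz_extension_lambda (@cst_continuousC _ _ _) Hk).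
  by rewrite /coz/= oner_eq0.
split; first exact: CB_cst.
by exists setT => //; rewrite interiorT.
Qed.

(** The constant 1 on [Y] has compact support, so its restriction to [X] lies in the ideal. *)
Lemma compact_unital : compact [set: Y] -> unital H.
Proof.
move=> cY; exists (cst 1).
  apply: (@C00_lambda_unit (cst 1)); apply: C00_intro.
    exact: cst_continuousC.
  by apply: (subclosed_compact _ cY) => //; exact: closed_closure.
by move=> f _; split; [exact: mul1r|exact: mulr1].
Qed.

End lambda.

(** * Uniqueness of [Y]: characters and the Banach-Stone argument *)

(* If the kernel of chi had no common zero on Y, compactness would provide k in
   the kernel, a sum of squares |f_i|^2, with phi k > 0 on the support of
   phi e; then phi e is a multiple of phi k and chi e = 0. *)
Lemma character_eval (R : realType) (X Y : topologicalType)
    (H : set (X -> R[i])) (phi : (X -> R[i]) -> (Y -> R[i]))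
    (chi : (X -> R[i]) -> R[i]) :
  CB_ideal H -> set_bij H (C00 R Y) phi ->
  (forall (a : R[i]) f g, H f -> H g -> phi (a *: f + g) = a *: phi f + phi g) ->
  (forall f g, H f -> H g -> phi (f * g) = phi f * phi g) ->
  (forall y, exists2 f, H f & phi f y != 0) ->
  (forall (a : R[i]) f g, H f -> H g -> chi (a *: f + g) = a * chi f + chi g) ->
  (forall f g, H f -> H g -> chi (f * g) = chi f * chi g) ->
  (exists2 e, H e & chi e != 0) ->
  exists y, forall f, H f -> chi f = phi f y.
Proof.
move=> [HCB _ HD HM] [phiC phi_inj phi_surj] phiL phiM phi_ne chiL chiM [e He chie].
have HMr f g : H f -> H g -> H (f * g) by move=> /HCB; exact: HM.
have HL (a : R[i]) f g : H f -> H g -> H (a *: f + g).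
  by move=> Hf Hg; apply: HD => //; apply: (HM (cst a)) => //; exact: CB_cst.
(* A common zero [y] of the kernel suffices: [f - (chi f / chi e) e] is in the kernel, so evaluation
   at [y] is proportional to [chi], and comparing the two at [e * e] makes the factor 1. *)
suff [y ker_y] : exists y, forall f, H f -> chi f = 0 -> phi f y = 0.
  have eE f : H f -> phi f y * chi e = chi f * phi e y.
    move=> Hf; have := ker_y (- (chi f / chi e) *: e + f) (HL _ _ _ He Hf).
    rewrite chiL// mulNr mulfVK// addNr => /(_ erefl).
    rewrite phiL// fctE /= => /eqP; rewrite fctE scaleNr addrC subr_eq0.
    by move=> /eqP ->; rewrite /GRing.scale/= mulrAC mulfVK.
  have ey0 : phi e y != 0.
    have [f Hf] := phi_ne y; apply: contra_neq => e0.
    by apply: (mulIf chie); rewrite eE// e0 mulr0 mul0r.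
  have ey : phi e y = chi e.
    apply: (mulfI ey0); apply: (mulIf chie).
    have := eE (e * e) (HMr _ _ He He); rewrite phiM// chiM// fctE => ->.
    by rewrite mulrC mulrA.
  by exists y => f /eE; rewrite ey => /(mulIf chie).
apply: contrapT => noy; move/negP : chie; apply.
have ny y : exists f, [/\ H f, chi f = 0 & phi f y != 0].
  apply: contrapT => nf; apply: noy; exists y => f Hf f0.
  by apply: contrapT => /eqP fy; apply: nf; exists f.
have [[ce _] cse] := phiC e He.
(* Nonnegativity of [phi k] prevents cancellation in sums, which handles unions. *)
pose P := [set S : set Y | exists2 k, H k /\ chi k = 0 &
  (forall y, 0 <= phi k y) /\ forall y, S y -> phi k y != 0].
have [k [Hk k0] [kge0 kne0]] : P (supp (phi e)).
  apply: compact_ind cse _ _ _ _.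
  - exists (-1 *: e + e); first by split; [exact: HL|rewrite chiL// mulN1r addNr].
    by split => // y; rewrite phiL// scaleN1r addNr.
  - by move=> A B AB [k hk [kge0 kB]]; exists k => //; split => // y /AB; exact: kB.
  - move=> A B [k [Hk k0] [kge0 kA]] [l [Hl l0] [lge0 lB]].
    exists (1 *: k + l); first by split; [exact: HL|rewrite chiL// k0 l0 mulr0 addr0].
    rewrite phiL// scale1r; split=> y; first by rewrite fctE addr_ge0.
    rewrite fctE paddr_eq0// negb_and => -[/kA ->//|/lB ->].
    by rewrite orbT.
  - move=> y _; have [f [Hf f0 fy]] := ny y.
    have [[cf _] csf] := phiC f Hf.
    (* [h] corresponds to the conjugate of [phi f], so [phi (f * h)] is the squared modulus, while
       [f * h] stays in the kernel. *)
    have [|h Hh hE] := phi_surj (fun y => (phi f y)^*%C).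
      apply: C00_intro; first exact: conjC_continuous.
      apply: (subclosed_compact _ csf); first exact: closed_closure.
      apply: closureS => x; rewrite /coz/=.
      by apply: contra_neq => ->; rewrite conjc0.
    exists (coz (phi f)).
      by apply: open_nbhs_nbhs; split => //; exact: coz_open.
    have kE x : phi (f * h) x = `|phi f x| ^+ 2.
      by rewrite phiM// hE fctE sqr_normc.
    exists (f * h); first by split; [exact: HMr|rewrite chiM// f0 mul0r].
    split=> x; first by rewrite kE exprn_ge0.
    by rewrite /coz/= kE sqrf_eq0 normr_eq0.
have [[ck _] _] := phiC k Hk.
pose q y := phi e y / phi k y.
have [|w Hw wE] := phi_surj q.
  apply: C00_intro.
    (* A zero of [phi k] lies off the support of [phi e], in an open set where [q] is 0; elsewhere
       the denominator is nonzero. *)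
    move=> y; have [ky|ky] := eqVneq (phi k y) 0.
      have nsy : (~` supp (phi e)) y by move=> /kne0; rewrite ky eqxx.
      have osy : open (~` supp (phi e)) by rewrite openC; exact: closed_closure.
      have q0 x : (~` supp (phi e)) x -> q x = 0.
        move=> nsx; rewrite /q (_ : phi e x = 0) ?mul0r//.
        apply: contrapT => /eqP; exact: (contra_not (@supp_subset _ _ _ _) nsx).
      rewrite /continuous_at q0// => U U0.
      apply: filterS (open_nbhs_nbhs (conj osy nsy)) => x nsx /=.
      by rewrite q0//; exact: nbhs_singleton.
    apply: (@cvgM _ _ (nbhs y) (nbhs_filter y)); first exact: ce.
    by apply: (@cvgV _ _ (nbhs y) (nbhs_filter y)) => //; exact: ck.
  apply: (subclosed_compact _ cse); first exact: closed_closure.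
  apply: closureS => x; rewrite /coz/=.
  by apply: contra_neq; rewrite /q => ->; rewrite mul0r.
suff -> : e = w * k by rewrite chiM// k0 mulr0.
apply: phi_inj; rewrite ?inE//; first exact: HMr.
apply/funext => y; rewrite phiM// wE fctE /q.
have [ky|ky] := eqVneq (phi k y) 0; last by rewrite mulfVK.
rewrite ky mulr0; apply: contrapT => /eqP ey.
by have := kne0 _ (@supp_subset _ _ (phi e) _ ey); rewrite ky eqxx.
Qed.

(** A bump at [y] inside the complement of [y'] would tell the points apart. *)
Lemma C00_separates (R : realType) (Y : topologicalType) (y y' : Y) :
  locally_compact_hausdorff Y -> (forall f, C00 R Y f -> f y = f y') -> y = y'.
Proof.
move=> lY yy'; apply: contrapT => ney; have [hY _] := lY.
have cy' : closed [set y'].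
  exact: accessible_closed_set1 (hausdorff_accessible hY) y'.
have [f Cf [fy fsub]] :=
  @locally_compact_bump R Y (~` [set y']) y lY (closed_openC cy') ney.
have fy' : coz f y' by rewrite /coz/= -(yy' f Cf).
exact: (fsub _ fy').
Qed.

(** Cozero-sets of [C00 R Y] form a base of [Y], and [tau] pulls the cozero-set of [phi f] back to
    that of [psi f], which is open. *)
Lemma eval_continuous (R : realType) (X Y Z : topologicalType)
    (H : set (X -> R[i])) (phi : (X -> R[i]) -> (Y -> R[i]))
    (psi : (X -> R[i]) -> (Z -> R[i])) (tau : Z -> Y) :
  locally_compact_hausdorff Y -> set_surj H (C00 R Y) phi ->
  (forall f, H f -> continuous (psi f)) ->
  (forall f z, H f -> psi f z = phi f (tau z)) -> continuous tau.
Proof.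
move=> lY phi_surj cpsi tauE z U; rewrite nbhsE => -[O [oO Oz] OU].
have [g Cg [gz gO]] := @locally_compact_bump R Y O (tau z) lY oO Oz.
have [f Hf fg] := phi_surj _ Cg.
have fz : coz (psi f) z by rewrite /coz/= tauE// fg.
apply: filterS (open_nbhs_nbhs (conj (coz_open (cpsi _ Hf)) fz)) => x.
by rewrite /coz/= tauE// fg => gx; apply/OU/gO.
Qed.

(** Evaluation of [psi f] at [z] is a nonzero character of [H], hence by [character_eval] an
    evaluation at a point of [Y]. *)
Lemma isometric_eval (R : realType) (X Y Z : topologicalType)
    (H : set (X -> R[i])) (phi : (X -> R[i]) -> (Y -> R[i]))
    (psi : (X -> R[i]) -> (Z -> R[i])) :
  CB_ideal H -> locally_compact_hausdorff Y -> locally_compact_hausdorff Z ->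
  set_bij H (C00 R Y) phi -> set_bij H (C00 R Z) psi ->
  (forall (a : R[i]) f g, H f -> H g -> phi (a *: f + g) = a *: phi f + phi g) ->
  (forall f g, H f -> H g -> phi (f * g) = phi f * phi g) ->
  (forall (a : R[i]) f g, H f -> H g -> psi (a *: f + g) = a *: psi f + psi g) ->
  (forall f g, H f -> H g -> psi (f * g) = psi f * psi g) ->
  exists2 tau : Z -> Y, continuous tau &
    forall f z, H f -> psi f z = phi f (tau z).
Proof.
move=> HI lY lZ bphi bpsi phiL phiM psiL psiM.
have [psiC _ psi_surj] := bpsi; have [_ _ phi_surj] := bphi.
have /choice[tau tauE] (z : Z) : exists y, forall f, H f -> psi f z = phi f y.
  apply: (@character_eval _ _ _ H phi (psi^~ z)) => //.
  - move=> y; have [g Cg [gy _]] := @locally_compact_bump R Y setT y lY openT I.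
    by have [f Hf fg] := phi_surj _ Cg; exists f => //; rewrite fg.
  - by move=> a f g Hf Hg; rewrite psiL.
  - by move=> f g Hf Hg; rewrite psiM.
  - have [g Cg [gz _]] := @locally_compact_bump R Z setT z lZ openT I.
    by have [f Hf fg] := psi_surj _ Cg; exists f => //; rewrite fg.
exists tau; last by move=> f z; exact: tauE.
apply: (eval_continuous lY phi_surj (psi := psi)) => //; last first.
  by move=> f z; exact: tauE.
by move=> f /psiC[[]].
Qed.

(** The point maps obtained in the two directions are mutually inverse because functions with
    compact support separate points. *)
Lemma C00_homeomorphic (R : realType) (X Y Z : topologicalType)
    (H : set (X -> R[i])) :
  CB_ideal H -> locally_compact_hausdorff Y -> locally_compact_hausdorff Z ->
  isometrically_isomorphic H (C00 R Y) ->
  isometrically_isomorphic H (C00 R Z) -> homeomorphic Z Y.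
Proof.
move=> HI lY lZ [phi [bphi phiL phiM _]] [psi [bpsi psiL psiM _]].
have [tau ctau tauE] := isometric_eval HI lY lZ bphi bpsi phiL phiM psiL psiM.
have [sig csig sigE] := isometric_eval HI lZ lY bpsi bphi psiL psiM phiL phiM.
have [_ _ phi_surj] := bphi; have [_ _ psi_surj] := bpsi.
exists tau, sig; split => // [z|y].
  apply: (C00_separates (R := R) lZ) => g /psi_surj[f Hf <-].
  by rewrite -sigE// -tauE.
apply: (C00_separates (R := R) lY) => g /phi_surj[f Hf <-].
by rewrite -tauE// -sigE.
Qed.

Theorem theorem2p1p14 (R : realType) (X : topologicalType) (I : set (set X)) :
  hausdorff_space X -> normal_space X -> set_ideal I -> locally_null I ->
  let H := C00_ideal R I in
  let Y : topologicalType := set_type (lambda_ideal R I) in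
  [/\ CB_ideal H,
      locally_compact_hausdorff Y /\ isometrically_isomorphic H (C00 R Y),
      forall Z : topologicalType, locally_compact_hausdorff Z ->
        isometrically_isomorphic H (C00 R Z) -> homeomorphic Z Y &
      [/\ (* (1) *)
          exists j : X -> Y,
            [/\ forall x, set_val (j x) = stone_cech_unit R x,
                topological_embedding j & dense (range j)],
          (* (2) *)
          non_vanishing H &
          (* (3) *)
          [<-> unital H; I [set: X]; compact [set: Y]]]].
Proof.
move=> hX nX idI lnI H Y.
have HI : CB_ideal H by exact: C00_ideal_CB_ideal.
have lY : locally_compact_hausdorff Y by exact: lambda_locally_compact.
have isoY : isometrically_isomorphic H (C00 R Y).
  exact: C00_ideal_isometric.
split => //.
  by move=> Z lZ isoZ; exact: C00_homeomorphic HI lY lZ isoY isoZ.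
split.
- exists (lambda_unit R hX nX lnI); split => //.
    exact: lambda_unit_embedding.
  exact: lambda_unit_dense.
- exact: C00_ideal_non_vanishing.
- tfae.
  + exact: unital_null.
  + exact: null_compact.
  + exact: compact_unital.
Qed.
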